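(* For $1\neq q\in\mathbb{Q}$ the following equality holds true: $$1+\sum_{n=1}^\infty\frac{q^nt^n}{(1-q)\cdots(1-q^n)}=\prod_{n=1}^\infty\frac{1}{1-q^nt}.$$
   Context: The equality is between power series in the variable $t$, in the setting of the algebra $\mathbb{Q}[[t]]$ of formal power series in $t$ with rational coefficients. Here $(1-q)\cdots(1-q^n)=\prod_{j=1}^n(1-q^j)$.
   Formalization: The product is a coefficientwise limit for an absolute value v on Q with v(q)<1: the usual one if |q|<1, a p-adic one if |q|>1, where the product diverges in the usual sense. The case q=-1 is excluded, since 1-q^2=0 and the product diverges. *)

(* Defs.v *)
From HB Require Import structures.
From mathcomp Require Import all_boot all_order all_algebra.
From mathcomp Require Import all_classical all_reals all_analysis.
Set Implicit Arguments.
Unset Strict Implicit.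
Unset Printing Implicit Defensive.
Import Order.TTheory GRing.Theory Num.Theory.
Import numFieldNormedType.Exports.
Local Open Scope classical_set_scope.
Local Open Scope ring_scope.

(* [coefs] is wrapped in a record so that the product is the Cauchy product and
   not the pointwise one that [nat -> K] already carries. *)
Record fps (K : fieldType) := Fps { coefs : nat -> K }.

Section FormalPowerSeries.
Variable K : fieldType.
Implicit Types (f g h : fps K) (a : K) (n : nat).

Lemma fpsP f g : (forall n, coefs f n = coefs g n) <-> f = g.
Proof.
split=> [|-> //]; case: f g => f [g] /= fg.
by congr Fps; apply: funext.
Qed.

HB.instance Definition _ := gen_eqMixin (fps K).
HB.instance Definition _ := gen_choiceMixin (fps K).

Definition fpsC a : fps K := Fps (fun n => if n == 0 then a else 0).
Definition fpsX : fps K := Fps (fun n => (n == 1)%:R).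
Definition fps_add f g := Fps (fun n => coefs f n + coefs g n).
Definition fps_opp f := Fps (fun n => - coefs f n).
Definition fps_mul f g :=
  Fps (fun n => \sum_(i < n.+1) coefs f i * coefs g (n - i)).

Fact fps_addA : associative fps_add.
Proof. by move=> f g h; apply/fpsP => n /=; rewrite addrA. Qed.
Fact fps_addC : commutative fps_add.
Proof. by move=> f g; apply/fpsP => n /=; rewrite addrC. Qed.
Fact fps_add0 : left_id (fpsC 0) fps_add.
Proof. by move=> f; apply/fpsP => n /=; rewrite if_same add0r. Qed.
Fact fps_addN : left_inverse (fpsC 0) fps_opp fps_add.
Proof. by move=> f; apply/fpsP => n /=; rewrite if_same addNr. Qed.
HB.instance Definition _ :=
  GRing.isZmodule.Build (fps K) fps_addA fps_addC fps_add0 fps_addN.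

Definition fps_trunc n f : {poly K} := \poly_(i < n.+1) coefs f i.

Lemma coef_fps_trunc n f i : (i <= n)%N -> (fps_trunc n f)`_i = coefs f i.
Proof. by move=> le_in; rewrite coef_poly ltnS le_in. Qed.

Lemma coef_mul_trunc n f g i : (i <= n)%N ->
  coefs (fps_mul f g) i = (fps_trunc n f * fps_trunc n g)`_i.
Proof.
move=> le_in; rewrite coefM; apply: eq_bigr => j _.
have le_ji : (j <= i)%N by rewrite -ltnS.
rewrite !coef_fps_trunc ?(leq_trans le_ji) //.
exact: leq_trans (leq_subr _ _) le_in.
Qed.

Fact fps_mulC : commutative fps_mul.
Proof.
by move=> f g; apply/fpsP => n; rewrite !(@coef_mul_trunc n) // mulrC.
Qed.
Fact fps_mulA : associative fps_mul.
Proof.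
move=> f g h; apply/fpsP => n.
have -> : coefs (fps_mul f (fps_mul g h)) n =
    (fps_trunc n f * (fps_trunc n g * fps_trunc n h))`_n.
  rewrite coefM; apply: eq_bigr => i _; congr (_ * _).
    by rewrite coef_fps_trunc // -ltnS.
  by rewrite (@coef_mul_trunc n) ?leq_subr.
rewrite mulrA coefM; apply: eq_bigr => i _; congr (_ * _).
  by rewrite (@coef_mul_trunc n) // -ltnS.
by rewrite coef_fps_trunc ?leq_subr.
Qed.
Fact fps_mul1 : left_id (fpsC 1) fps_mul.
Proof.
move=> f; apply/fpsP => n /=.
by rewrite big_ord_recl /= subn0 mul1r big1 ?addr0 // => i _; rewrite mul0r.
Qed.
Fact fps_mulDl : left_distributive fps_mul fps_add.
Proof.
move=> f g h; apply/fpsP => n /=.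
by rewrite -big_split; apply: eq_bigr => i _; rewrite mulrDl.
Qed.
Fact fps_one_neq0 : fpsC 1 != 0.
Proof. by apply/eqP => /fpsP /(_ 0) /= /eqP; rewrite oner_eq0. Qed.
HB.instance Definition _ := GRing.Zmodule_isComNzRing.Build (fps K)
  fps_mulA fps_mulC fps_mul1 fps_mulDl fps_one_neq0.

Definition fps_unit : {pred fps K} := fun f => `[< exists g, g * f = 1 >].
Definition fps_inv f : fps K := xget f [set g | g * f = 1].

Fact fps_mulVf : {in fps_unit, left_inverse 1 fps_inv *%R}.
Proof. by move=> f /asboolP [g gf1]; exact: (@xgetI _ f [set g | g * f = 1] g gf1). Qed.
Fact fps_unitPl f g : g * f = 1 -> fps_unit f.
Proof. by move=> gf1; apply/asboolP; exists g. Qed.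
Fact fps_inv_out : {in [predC fps_unit], fps_inv =1 id}.
Proof.
move=> f /negP nU; rewrite /fps_inv xgetPN // => g gf1.
by apply: nU; apply: fps_unitPl gf1.
Qed.
HB.instance Definition _ := GRing.ComNzRing_hasMulInverse.Build (fps K)
  fps_mulVf fps_unitPl fps_inv_out.

Lemma coefs_geometric a n : coefs (1 - fpsC a * fpsX)^-1 n = a ^+ n.
Proof.
pose G : fps K := Fps (fun n => a ^+ n).
suff G1 : G * (1 - fpsC a * fpsX) = 1.
  suff <- : G = (1 - fpsC a * fpsX)^-1 by [].
  have U : (1 - fpsC a * fpsX) \is a GRing.unit by apply/asboolP; exists G.
  by rewrite -[LHS](mulrK U) G1 mul1r.
have coefGX k : coefs (fpsX * G) k = if k is k'.+1 then a ^+ k' else 0.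
  rewrite /= ; case: k => [|k]; first by rewrite big_ord1 mul0r.
  rewrite big_ord_recl mul0r add0r big_ord_recl /= mul1r subn1 big1 ?addr0 //.
  by move=> i _; rewrite mul0r.
rewrite mulrBr mulr1 mulrC -mulrA.
apply/fpsP => k; rewrite -[LHS]/(a ^+ k - coefs (fpsC a * (fpsX * G)) k).
rewrite -[coefs (_ * _) k]/(\sum_(i < k.+1) _) big_ord_recl big1 ?addr0; last first.
  by move=> i _; rewrite mul0r.
rewrite subn0 coefGX -[coefs (fpsC a) _]/a.
by case: k => [|k]; rewrite ?mulr0 ?subr0 // -exprS subrr.
Qed.

End FormalPowerSeries.

Section Convergence.
Variables (K : fieldType) (R : realType).

(* By Ostrowski's theorem, for K = rat these are the trivial absolute value and
   the powers of the usual and of the p-adic ones. *)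
Definition absolute_value (v : K -> R) : Prop :=
  [/\ forall x, 0 <= v x,
      forall x, v x = 0 <-> x = 0,
      forall x y, v (x * y) = v x * v y &
      forall x y, v (x + y) <= v x + v y].

(* Coefficientwise convergence in K[[t]], K being topologized by v. *)
Definition fps_cvg (v : K -> R) (F : nat -> fps K) (G : fps K) : Prop :=
  forall n, (fun N => v (coefs (F N) n - coefs G n)) @ \oo --> (0 : R).

Definition fps_prod_cvg (v : K -> R) (f : nat -> fps K) (G : fps K) : Prop :=
  fps_cvg v (fun N => \prod_(1 <= n < N.+1) f n) G.

End Convergence.

Lemma absolute_value_norm (R : realType) :
  absolute_value (fun x : rat => `|ratr x| : R).
Proof.
split=> [x|x|x y|x y] //.
- by split=> [/eqP|->]; [rewrite normr_eq0 fmorph_eq0 => /eqP | rewrite raddf0 normr0].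
- by rewrite rmorphM normrM.
- by rewrite rmorphD ler_normD.
Qed.

(* An infinite sum \sum_n c_n t^n is the series with coefficients c_n.  For
   q = -1 the denominators vanish from n = 2 on, and the quotient is then 0. *)
Definition euler_series (q : rat) : fps rat :=
  1 + Fps (fun n => if n == 0 then 0
                    else q ^+ n / \prod_(1 <= j < n.+1) (1 - q ^+ j)).

Definition euler_factor (q : rat) (n : nat) : fps rat :=
  (1 - fpsC (q ^+ n) * fpsX rat)^-1.

(* Main.v *)
Require Import Defs.
From HB Require Import structures.
From mathcomp Require Import all_boot all_order all_algebra.
From mathcomp Require Import all_classical all_reals all_analysis.
From mathcomp Require Import ring.
Import Order.TTheory GRing.Theory Num.Theory.
Import numFieldNormedType.Exports.
Local Open Scope classical_set_scope.
Local Open Scope ring_scope.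

(** The partial products P_N = \prod_(1 <= n <= N) 1 / (1 - q^n t) satisfy the
    finite functional equation
      P_N(q t) (1 - q^(N+1) t) = P_N(t) (1 - q t),
    because both sides have the same factors.  On coefficients it reads
      (1 - q^(n+1)) c_(N,n+1) = q (1 - q^(N+n)) c_(N,n)
    ([coef_partial_prod_rec]), while the coefficients e_n of the series on the
    other side satisfy the limiting recurrence (1 - q^(n+1)) e_(n+1) = q e_n.
    If |q| < 1, then q^(N+n) tends to 0 and no 1 - q^(n+1) vanishes, so
    c_(N,n) tends to e_n by induction on n ([euler_prod_cvg]).

    Conversely, c_(N+1,1) - c_(N,1) = q^(N+1), so convergence of the
    coefficient of t alone already forces |q| < 1
    ([prod_cvg_absv_lt1]); limits being unique, the product can only converge
    to the Euler series.

    Finally, a rational q other than 1 and -1 (where 1 - q^2 vanishes) is small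
    for some absolute value:
    the usual one if |q| < 1, and otherwise the p-adic one for a prime p
    dividing the numerator of q, which is then at least 2 in absolute value
    ([exists_absv_lt1]). *)

(** * Coefficients of the partial products *)

Definition partial_prod (q : rat) (N : nat) : fps rat :=
  \prod_(1 <= n < N.+1) euler_factor q n.

Lemma coef_partial_prod0 (q : rat) (n : nat) :
  coefs (partial_prod q 0) n = (n == 0%N)%:R.
Proof. by rewrite /partial_prod big_nil /=; case: n. Qed.

Lemma coef_partial_prodS (q : rat) (N n : nat) :
  coefs (partial_prod q N.+1) n =
  \sum_(i < n.+1) coefs (partial_prod q N) i * (q ^+ N.+1) ^+ (n - i).
Proof.
rewrite /partial_prod big_nat_recr //=.
by apply: eq_bigr => i _; rewrite coefs_geometric.
Qed.

Lemma coef_partial_prod_const (q : rat) (N : nat) :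
  coefs (partial_prod q N) 0 = 1.
Proof.
elim: N => [|N IH]; first by rewrite coef_partial_prod0.
by rewrite coef_partial_prodS big_ord1 IH mul1r.
Qed.

(** This is P_(N+1) (1 - q^(N+1) t) = P_N read on coefficients. *)
Lemma coef_partial_prod_pascal (q : rat) (N n : nat) :
  coefs (partial_prod q N.+1) n.+1 =
  coefs (partial_prod q N) n.+1 + q ^+ N.+1 * coefs (partial_prod q N.+1) n.
Proof.
rewrite !coef_partial_prodS big_ord_recr /= subnn expr0 mulr1 addrC.
congr (_ + _); rewrite mulr_sumr; apply: eq_bigr => i _.
by rewrite subSn -1?ltnS // [_ ^+ (_ - _).+1]exprS mulrCA.
Qed.

(** The functional equation P_N(q t) (1 - q^(N+1) t) = P_N(t) (1 - q t) read on
    coefficients; it follows from the Pascal-like recurrence by a double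
    induction on N and n. *)
Lemma coef_partial_prod_rec (q : rat) (N n : nat) :
  (1 - q ^+ n.+1) * coefs (partial_prod q N) n.+1 =
  q * (1 - q ^+ (N + n)) * coefs (partial_prod q N) n.
Proof.
elim: N n => [|N IHN] n.
  rewrite !coef_partial_prod0 add0n mulr0.
  by case: n => [|n]; rewrite ?expr0 ?subrr ?mulr0 ?mul0r.
elim: n => [|n IHn].
  rewrite coef_partial_prod_pascal mulrDr IHN !coef_partial_prod_const !addn0.
  by rewrite !exprS; ring.
have prevE : coefs (partial_prod q N) n.+1 =
    coefs (partial_prod q N.+1) n.+1
    - q ^+ N.+1 * coefs (partial_prod q N.+1) n.
  by rewrite coef_partial_prod_pascal addrK.
rewrite coef_partial_prod_pascal mulrDr IHN prevE.
move: IHn; rewrite !addSn !addnS !exprS !exprD.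
move: (coefs _ _) (coefs _ _) => c d IH.
(* The induction hypothesis, multiplied by q^(N+1), removes the coefficient of
   index n. *)
apply/eqP; rewrite -subr_eq0; apply/eqP.
transitivity (q * q ^+ N *
  ((1 - q * q ^+ n) * d - q * (1 - q * (q ^+ N * q ^+ n)) * c)).
  by ring.
by rewrite IH subrr mulr0.
Qed.

Lemma coef_euler_series0 (q : rat) : coefs (euler_series q) 0 = 1.
Proof. by rewrite /= addr0. Qed.

Lemma coef_euler_series_rec (q : rat) (n : nat) : 1 - q ^+ n.+1 != 0 ->
  (1 - q ^+ n.+1) * coefs (euler_series q) n.+1 = q * coefs (euler_series q) n.
Proof.
move=> nz.
have coefE k : coefs (euler_series q) k =
    q ^+ k / \prod_(1 <= j < k.+1) (1 - q ^+ j).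
  by case: k => [|k] /=; rewrite ?addr0 ?add0r // big_nil divr1.
rewrite !coefE big_nat_recr //= mulrC.
by rewrite invfM [q * _]mulrA [_ * (_ / _)]mulrA divfK // exprS.
Qed.

(** * Absolute values and convergence *)

Section AbsoluteValue.
Context {K : fieldType} {R : realType} {v : K -> R}.
Hypothesis absv : absolute_value v.

Lemma absv_ge0 x : 0 <= v x. Proof. by case: absv. Qed.
Lemma absvM x y : v (x * y) = v x * v y. Proof. by case: absv. Qed.
Lemma absvD x y : v (x + y) <= v x + v y. Proof. by case: absv. Qed.
Lemma absv_eq0 x : (v x == 0) = (x == 0).
Proof. by case: absv => _ v0 _ _; apply/eqP/eqP => /v0. Qed.

Lemma absv1 : v 1 = 1.
Proof.
have nz : v 1 != 0 by rewrite absv_eq0 oner_eq0.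
by apply: (mulfI nz); rewrite -absvM !mulr1.
Qed.

Lemma absvN x : v (- x) = v x.
Proof.
suff vN1 : v (-1) = 1 by rewrite -mulN1r absvM vN1 mul1r.
have /eqP : v (-1) ^+ 2 = 1 by rewrite expr2 -absvM mulrNN mulr1 absv1.
rewrite sqrf_eq1 => /orP[/eqP //|/eqP vE].
by have := absv_ge0 (-1); rewrite vE oppr_ge0 ler10.
Qed.

Lemma absvB x y : v (x - y) <= v x + v y.
Proof. by rewrite -(absvN y) absvD. Qed.

Lemma absvX x n : v (x ^+ n) = v x ^+ n.
Proof. by elim: n => [|n IH]; rewrite ?expr0 ?absv1 // !exprS absvM IH. Qed.

Lemma absv_lt1_subX_neq0 x n : v x < 1 -> 1 - x ^+ n.+1 != 0.
Proof.
move=> x1; rewrite subr_eq0; apply/eqP => xE.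
have : v x ^+ n.+1 < 1 by rewrite exprn_ilt1 ?absv_ge0.
by rewrite -absvX -xE absv1 ltxx.
Qed.

Lemma absv_squeeze (u : nat -> R) (x : nat -> K) :
  (forall N, v (x N) <= u N) -> u N @[N --> \oo] --> (0 : R) ->
  v (x N) @[N --> \oo] --> (0 : R).
Proof.
move=> ux u0; apply: (squeeze_cvgr _ (cvg_cst 0) u0).
by near=> N; rewrite absv_ge0 ux.
Unshelve. all: by end_near.
Qed.

Lemma absv_cvg_unique (x : nat -> K) a b :
  v (x N - a) @[N --> \oo] --> (0 : R) ->
  v (x N - b) @[N --> \oo] --> (0 : R) -> a = b.
Proof.
move=> xa xb; apply/eqP; rewrite -subr_eq0 -absv_eq0; apply/eqP.
have s0 : v (x N - b) + v (x N - a) @[N --> \oo] --> (0 : R).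
  by rewrite -[X in _ --> X]addr0; apply: cvgD.
have c0 : v (a - b) @[_ --> \oo] --> (0 : R).
  apply: (absv_squeeze _ (fun=> a - b) _ s0) => N.
  by rewrite (_ : a - b = (x N - b) - (x N - a)) ?absvB //; ring.
exact: (cvg_unique _ (cvg_cst (v (a - b)) : _ @ \oo --> _) c0).
Qed.

Lemma absvX_cvg0 x (k : nat) : v x < 1 ->
  v (x ^+ (N + k)) @[N --> \oo] --> (0 : R).
Proof.
move=> x1; under eq_fun do rewrite absvX.
have : (v x ^+ N) @[N --> \oo] --> (0 : R).
  by apply: cvg_expr; rewrite ger0_norm ?absv_ge0.
by rewrite -(cvg_shiftn k).
Qed.

End AbsoluteValue.

(** * Convergence of the Euler product *)

Lemma euler_prod_cvg {R : realType} (v : rat -> R) (q : rat) :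
  absolute_value v -> v q < 1 ->
  fps_prod_cvg v (euler_factor q) (euler_series q).
Proof.
move=> absv q1; rewrite /fps_prod_cvg /fps_cvg; elim=> [|n IH].
  under eq_fun do rewrite coef_partial_prod_const coef_euler_series0 subrr.
  have /eqP -> : v 0 == 0 by rewrite (absv_eq0 absv).
  exact: cvg_cst.
have nz := absv_lt1_subX_neq0 absv q n q1.
set e := coefs (euler_series q) n in IH.
pose d N := coefs (partial_prod q N) n - e.
(* Subtracting the two recurrences expresses the error at index n+1 by the
   error at index n and a multiple of q^(N+n). *)
have errE N : coefs (partial_prod q N) n.+1 - coefs (euler_series q) n.+1 =
    (1 - q ^+ n.+1)^-1 * (q * d N - q * q ^+ (N + n) * (d N + e)).
  apply: (mulfI nz); rewrite mulrA mulfV // mul1r mulrBr.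
  rewrite coef_partial_prod_rec coef_euler_series_rec // -/e /d; ring.
pose u N := v (1 - q ^+ n.+1)^-1 *
  (v q * v (d N) + v q * v (q ^+ (N + n)) * (v (d N) + v e)).
apply: (absv_squeeze absv u) => [N|].
  rewrite /= errE (absvM absv) ler_wpM2l ?absv_ge0 //.
  apply: (le_trans (absvB absv _ _)); rewrite !(absvM absv) lerD2l.
  by rewrite ler_wpM2l ?mulr_ge0 ?absv_ge0 ?absvD.
have -> : 0 = v (1 - q ^+ n.+1)^-1 * (v q * 0 + v q * 0 * (0 + v e)) :> R.
  by rewrite !(mulr0, mul0r, addr0).
apply: cvgMr; apply: cvgD; first exact: cvgMr IH.
apply: cvgM; first by apply: cvgMr; apply: absvX_cvg0.
by apply: cvgD; [exact: IH | exact: cvg_cst].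
Qed.

(** The coefficient of t in the N-th partial product is q + ... + q^N, so its
    convergence makes the increments q^(N+1) tend to 0; but v q^(N+1) >= 1 if
    v q >= 1. *)
Lemma prod_cvg_absv_lt1 {R : realType} (v : rat -> R) (q : rat) (P : fps rat) :
  absolute_value v -> fps_prod_cvg v (euler_factor q) P -> v q < 1.
Proof.
move=> absv /(_ 1%N) c0; rewrite ltNge; apply/negP => q1.
pose c N := coefs (partial_prod q N) 1.
have c0S : v (c N.+1 - coefs P 1) @[N --> \oo] --> (0 : R).
  by rewrite -cvg_shiftS in c0.
have s0 : v (c N.+1 - coefs P 1) + v (c N - coefs P 1) @[N --> \oo] --> (0 : R).
  by rewrite -[X in _ --> X]addr0; apply: cvgD.
have c1 : (1 : R) @[_ --> \oo] --> (1 : R) by exact: cvg_cst.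
have : 1 <= (0 : R).
  apply: (ler_cvg_to c1 s0); near=> N.
  rewrite (le_trans _ (absvB absv _ _)) //.
  rewrite /c coef_partial_prod_pascal coef_partial_prod_const.
  set x := coefs _ 1; set y := coefs P 1.
  rewrite (_ : _ - _ = q ^+ N.+1); last by ring.
  by rewrite absvX // exprn_ege1.
by rewrite ler10.
Unshelve. all: by end_near.
Qed.

(** * p-adic absolute values *)

Section PadicAbsoluteValue.
Context {R : realType} (p : nat).
Hypothesis p_pr : prime p.

Definition padic_int (m : int) : R :=
  if m == 0 then 0 else p%:R^-1 ^+ logn p `|m|%N.

Definition padic (x : rat) : R := padic_int (numq x) / padic_int (denq x).

Let p_gt0 : 0 < (p%:R^-1 : R).
Proof. by rewrite invr_gt0 ltr0n prime_gt0. Qed.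

Lemma padic_int_ge0 m : 0 <= padic_int m.
Proof. by rewrite /padic_int; case: ifP => // _; rewrite exprn_ge0 ?ltW. Qed.

Lemma padic_int_eq0 m : (padic_int m == 0) = (m == 0).
Proof.
rewrite /padic_int; case: ifP => [_|_]; first by rewrite eqxx.
by rewrite expf_eq0 gt_eqF // andbF.
Qed.

Lemma padic_intM m n : padic_int (m * n) = padic_int m * padic_int n.
Proof.
rewrite /padic_int mulf_eq0.
have [_|m0] /= := eqVneq m 0; first by rewrite mul0r.
have [_|n0] /= := eqVneq n 0; first by rewrite mulr0.
by rewrite abszM lognM ?absz_gt0 // exprD.
Qed.

(** The ultrametric inequality: the p-part common to m and n divides m + n. *)
Lemma padic_intD m n : padic_int (m + n) <= padic_int m + padic_int n.
Proof.
have [->|m0] := eqVneq m 0; first by rewrite add0r lerDr padic_int_ge0.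
have [->|n0] := eqVneq n 0; first by rewrite addr0 lerDl padic_int_ge0.
have [->|mn0] := eqVneq (m + n) 0.
  by rewrite {1}/padic_int eqxx addr_ge0 ?padic_int_ge0.
wlog le_mn : m n m0 n0 mn0 / (logn p `|m| <= logn p `|n|)%N.
  move=> wl; have [/wl|/ltnW/wl] := leqP (logn p `|m|) (logn p `|n|); first exact.
  by rewrite addrC [padic_int n + _]addrC; apply; rewrite // addrC.
have le_mD : (logn p `|m| <= logn p `|(m + n)%R|)%N.
  have in_dvdz (k : int) : k != 0 -> (k \in dvdz (p ^ logn p `|m|)%N) =
      (logn p `|m| <= logn p `|k|)%N.
    by move=> k0; rewrite -pfactor_dvdn ?absz_gt0.
  by rewrite -in_dvdz // rpredD // in_dvdz.
apply: (@le_trans _ _ (padic_int m)); last by rewrite lerDl padic_int_ge0.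
rewrite /padic_int (negPf m0) (negPf mn0) ler_wiXn2l // ?(ltW p_gt0) //.
by rewrite invf_le1 ?ler1n ?ltr0n prime_gt0.
Qed.

(** Since the value does not depend on the fraction chosen for x, both the
    multiplicativity and the triangle inequality reduce to integers, by
    bringing fractions to a common denominator. *)
Lemma padic_frac (m n : int) : n != 0 ->
  padic (m%:~R / n%:~R) = padic_int m / padic_int n.
Proof.
move=> n0; set x := _ / _.
have crossE : numq x * n = m * denq x.
  apply/eqP; rewrite -(eqr_int rat) !rmorphM /=.
  have -> : (numq x)%:~R = x * (denq x)%:~R :> rat.
    by rewrite -{2}(divq_num_den x) divfK ?intr_eq0 ?denq_neq0.
  by rewrite mulrAC /x divfK ?intr_eq0.
apply/eqP; rewrite /padic eqr_div ?padic_int_eq0 ?denq_neq0 //.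
by rewrite -!padic_intM crossE.
Qed.

Lemma absolute_value_padic : absolute_value padic.
Proof.
have denq_nz x : padic_int (denq x) != 0 by rewrite padic_int_eq0 denq_neq0.
have den_nz x : (denq x)%:~R != 0 :> rat by rewrite intr_eq0 denq_neq0.
split=> [x|x|x y|x y].
- by rewrite divr_ge0 ?padic_int_ge0.
- have : (padic x == 0) = (x == 0).
    by rewrite mulf_eq0 invr_eq0 (negPf (denq_nz x)) orbF padic_int_eq0 numq_eq0.
  by move=> E; split=> /eqP; [rewrite E | rewrite -E] => /eqP.
- rewrite -{1}(divq_num_den x) -{1}(divq_num_den y) mulf_div -!rmorphM /=.
  by rewrite padic_frac ?mulf_neq0 ?denq_neq0 // !padic_intM -mulf_div.
rewrite -{1}(divq_num_den x) -{1}(divq_num_den y) addf_div //.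
rewrite -!rmorphM -rmorphD /= padic_frac ?mulf_neq0 ?denq_neq0 //.
rewrite /padic addf_div // -!padic_intM ler_wpM2r ?padic_intD //.
by rewrite invr_ge0 padic_int_ge0.
Qed.

Lemma padic_lt1 (x : rat) : (p %| `|numq x|)%N -> padic x < 1.
Proof.
move=> p_num.
have p_den : ~~ (p %| `|denq x|)%N.
  apply/negP => p_den; have := coprime_num_den x.
  rewrite /coprime => /eqP g1; have : (p %| 1)%N by rewrite -g1 dvdn_gcd p_num.
  by rewrite dvdn1; case: (p) p_pr => [|[]].
have [x0|x0] := eqVneq x 0.
  by rewrite /padic x0 /padic_int eqxx mul0r.
rewrite /padic /padic_int numq_eq0 (negPf x0) (negPf (denq_neq0 x)).
rewrite [logn p `|denq x|]lognE (negPf p_den) !andbF expr0 divr1.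
rewrite exprn_ilt1 ?(ltW p_gt0) //.
  by rewrite -lt0n -pfactor_dvdn ?expn1 // absz_gt0 numq_eq0.
by rewrite invf_lt1 ?ltr1n ?prime_gt1 // ltr0n prime_gt0.
Qed.

End PadicAbsoluteValue.

Lemma exists_absv_lt1 (R : realType) (q : rat) : `|q| != 1 ->
  exists v : rat -> R, absolute_value v /\ v q < 1.
Proof.
move=> q1; have [lt1|ge1] := ltP `|q| 1.
  exists (fun x => `|ratr x|); split; first exact: absolute_value_norm.
  by rewrite -ratr_norm -(rmorph1 (ratr : rat -> R)) ltr_rat.
have gt1 : 1 < `|q| by rewrite lt_neqAle eq_sym q1.
have num_gt1 : (1 < `|numq q|)%N.
  rewrite -ltz_nat -(ltr_int rat) abszE intr_norm.
  have -> : (numq q)%:~R = q * (denq q)%:~R :> rat.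
    by rewrite -{2}(divq_num_den q) divfK ?intr_eq0 ?denq_neq0.
  rewrite normrM; apply: (lt_le_trans gt1); rewrite ler_peMr //.
  by rewrite -intr_norm ler1z gtr0_norm ?denq_gt0 // -gtz0_ge1 denq_gt0.
have p_pr := pdiv_prime num_gt1.
exists (padic (pdiv `|numq q|)); split; first exact: absolute_value_padic.
by apply: padic_lt1; rewrite ?pdiv_dvd.
Qed.

Theorem proposition2 (R : realType) (q : rat) (q_neq1 : q <> 1) :
  [/\ (* the identity, for every absolute value on Q such that |q| < 1 *)
      forall v : rat -> R, absolute_value v -> v q < 1 ->
        fps_prod_cvg v (euler_factor q) (euler_series q),
      (* the product has no other value, whenever and wherever it converges *)
      forall (v : rat -> R) (P : fps rat), absolute_value v ->
        fps_prod_cvg v (euler_factor q) P -> P = euler_series q &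
      (* it does converge for every q <> 1 such that no 1 - q^n vanishes *)
      (forall n : nat, (0 < n)%N -> 1 - q ^+ n <> 0) ->
        exists v : rat -> R, absolute_value v /\
          fps_prod_cvg v (euler_factor q) (euler_series q)].
Proof.
split=> [v|v P absv cvgP|q_nroot].
- exact: euler_prod_cvg.
- have q1 := prod_cvg_absv_lt1 _ _ _ absv cvgP.
  apply/fpsP => n.
  exact: (absv_cvg_unique absv _ _ _ (cvgP n) (euler_prod_cvg _ _ absv q1 n)).
have /(exists_absv_lt1 R)[v [absv q1]] : `|q| != 1.
  apply/eqP => /eqP; rewrite -sqr_norm_eq1 => /eqP q2.
  by apply: (q_nroot 2%N) => //; rewrite q2 subrr.
by exists v; split=> //; apply: euler_prod_cvg.
Qed.
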